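(* Let $X$ be a strongly star-Lindelöf topological space. If $X$ is a union of fewer than $\mathfrak{d}$ Hurewicz subspaces, then $X$ is strongly star-Scheepers.
   Context: For $A\subseteq X$ and a family $\mathcal{P}$ of subsets of $X$, $St(A,\mathcal{P})=\bigcup\{B\in\mathcal{P} : A\cap B\neq\emptyset\}$. $X$ is strongly star-Lindelöf if for every open cover $\mathcal{U}$ of $X$ there is a countable $A\subseteq X$ with $St(A,\mathcal{U})=X$. An $\omega$-cover of $X$ is an open cover $\mathcal{U}$ such that every finite $F\subseteq X$ is contained in some member of $\mathcal{U}$. $X$ is strongly star-Scheepers if for each sequence $(\mathcal{U}_n)_{n\in\mathbb{N}}$ of open covers of $X$ there are finite sets $F_n\subseteq X$ such that $\{St(F_n,\mathcal{U}_n) : n\in\mathbb{N}\}$ is an $\omega$-cover of $X$. A space $X$ is Hurewicz if for each sequence $(\mathcal{U}_n)_{n\in\mathbb{N}}$ of open covers of $X$ there are finite $\mathcal{V}_n\subseteq\mathcal{U}_n$ such that each $x\in X$ belongs to $\bigcup\mathcal{V}_n$ for all but finitely many $n$, or $\bigcup\mathcal{V}_n=X$ for some $n$ (this is the selection principle $U_{fin}(\mathcal{O},\Gamma)$). $\mathfrak{d}$ is the minimum cardinality of a dominating subset of $\mathbb{N}^{\mathbb{N}}$, where $D$ is dominating if for every $g\in\mathbb{N}^{\mathbb{N}}$ there is $f\in D$ with $g(n)\leq f(n)$ for all but finitely many $n$. *)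

(* Defs.v *)
From mathcomp Require Import all_boot all_classical topology.

Set Implicit Arguments.
Unset Strict Implicit.
Unset Printing Implicit Defensive.

Local Open Scope classical_set_scope.
Local Open Scope card_scope.

Definition St (X : Type) (A : set X) (P : set (set X)) : set X :=
  \bigcup_(B in [set B | P B /\ A `&` B !=set0]) B.

Definition open_cover (X : topologicalType) (U : set (set X)) : Prop :=
  (forall B, U B -> open B) /\ \bigcup_(B in U) B = [set: X].

(* [set: X] itself is allowed as a member. *)
Definition omega_cover (X : topologicalType) (U : set (set X)) : Prop :=
  open_cover U /\
  forall F : set X, finite_set F -> exists2 B, U B & F `<=` B.

Definition strongly_star_lindelof (X : topologicalType) : Prop :=
  forall U : set (set X), open_cover U ->
    exists2 A : set X, countable A & St A U = [set: X].

Definition strongly_star_scheepers (X : topologicalType) : Prop :=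
  forall U : nat -> set (set X), (forall n, open_cover (U n)) ->
    exists2 F : nat -> set X, (forall n, finite_set (F n)) &
      omega_cover [set St (F n) (U n) | n in [set: nat]].

Definition hurewicz (X : topologicalType) : Prop :=
  forall U : nat -> set (set X), (forall n, open_cover (U n)) ->
    exists2 V : nat -> set (set X),
      (forall n, V n `<=` U n /\ finite_set (V n)) &
      (forall x : X, \forall n \near \oo, (\bigcup_(B in V n) B) x) \/
      (exists n, \bigcup_(B in V n) B = [set: X]).

(* [set_type A] carries the topology induced by [X]; the library's [subspace A]
   is a topology on all of [X] that isolates the points outside [A]. *)
Definition hurewicz_subspace (X : topologicalType) (A : set X) : Prop :=
  hurewicz (set_type A).

Definition dominating (D : set (nat -> nat)) : Prop :=
  forall g : nat -> nat, exists2 f, D f & \forall n \near \oo, (g n <= f n)%N.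

(* There is no type of cardinals: the cardinal d is represented by the
   dominating sets of least cardinality, which exist by [ex_card_d]. *)
Definition card_d (D : set (nat -> nat)) : Prop :=
  dominating D /\ forall E, dominating E -> D #<= E.

Definition card_lt (T U : Type) (A : set T) (B : set U) : Prop :=
  A #<= B /\ ~ (B #<= A).

Definition card_lt_d (T : Type) (A : set T) : Prop :=
  exists2 D, card_d D & card_lt A D.

(* A maximal set of choice functions of [F] that are pairwise different at
   every member of [F] is mapped onto some member by evaluation. *)
Lemma ex_card_min (T : pointedType) (F : set (set T)) :
  F !=set0 -> exists2 D, F D & forall E, F E -> D #<= E.
Proof.
move=> [D0 FD0].
pose P (M : set (set T -> T)) :=
  (forall p D, M p -> F D -> D (p D)) /\
  (forall p q D, M p -> M q -> F D -> p D = q D -> p = q).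
have chainP (C : set (set (set T -> T))) :
    C `<=` P -> total_on C subset -> P (\bigcup_(M in C) M).
  move=> CP Ctot; split=> [p D [M CM Mp]|p q D [M CM Mp] [N CN Nq]] FD.
    by have [MF _] := CP _ CM; exact: MF Mp FD.
  have [MN|NM] := Ctot _ _ CM CN.
  - by case: (CP _ CN) => _ /(_ p q D); apply=> //; exact: MN.
  - by case: (CP _ CM) => _ /(_ p q D); apply=> //; exact: NM.
have [M [[MF Minj] Mmax]] := Zorn_bigcup chainP.
suff [D FD Donto] : exists2 D, F D & D `<=` [set p D | p in M].
  exists D => // E FE.
  apply: card_le_trans (subset_card_le Donto) _.
  apply: card_le_trans (card_image_le _ _) _.
  have injE : {in M &, injective (fun p : set T -> T => p E)}.
    by move=> p q /set_mem Mp /set_mem Mq; exact: Minj.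
  rewrite -(card_le_eql (inj_card_eq injE)).
  by apply: subset_card_le => _ [p Mp <-]; exact: MF Mp FE.
apply: contrapT => noD.
have /choice[p pP] : forall D, exists x,
    F D -> D x /\ ~ [set p D | p in M] x.
  move=> D; have [FD|nFD] := pselect (F D); last by exists point.
  apply: contrapT => nx; apply: noD; exists D => // x Dx.
  by apply: contrapT => nMx; apply: nx; exists x.
have Mp : M p.
  apply: contrapT => nMp; apply: (Mmax (M `|` [set p])).
    split; first by move=> q Mq; left.
    by move=> sub; apply: nMp; apply: sub; right.
  split=> [q D [Mq|->] FD|q r D [Mq|->] [Mr|->] FD e] //.
  - exact: MF Mq FD.
  - by case: (pP D FD).
  - exact: (Minj q r D).
  - by case: (pP D FD) => _ []; exists q.
  - by case: (pP D FD) => _ []; exists r.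
by case: (pP D0 FD0) => _; apply; exists p.
Qed.

Lemma ex_card_d : exists D, card_d D.
Proof.
have [|D domD minD] := @ex_card_min (nat -> nat) dominating.
  by exists setT => g; exists g => //; exact: nearW.
by exists D.
Qed.

(* Main.v *)
(** Let [K m] be the points of index at most [m] in a countable set whose stars
    cover [X] for every [U n]. For fixed [n] the sets [St (K m) (U n)] increase to
    [X], so every Hurewicz piece [B] has a function [f B] such that each [x] in [B]
    lies in [St (K (f B n)) (U n)] for almost all [n]. There are fewer than d
    pieces, hence fewer than d maxima of finitely many of the [f B], and some [g]
    is not dominated by any of them. Then [F n = K (g n)] works: a finite set
    lies in the union of finitely many pieces, and [g] exceeds the maximum of
    their functions infinitely often. That an infinite set has as many finite
    sequences as elements is proved with Zorn's lemma. *)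

Require Import Defs.
From mathcomp Require Import all_boot all_classical topology.

Local Open Scope classical_set_scope.
Local Open Scope card_scope.

(** * Comparison of cardinals *)

Lemma fun_card_le {T U : Type} (A : set T) (B : set U) (f : T -> U) :
  (forall x, A x -> B (f x)) ->
  (forall x y, A x -> A y -> f x = f y -> x = y) -> A #<= B.
Proof.
move=> fAB finj.
have /injfunPex[g] : exists2 g : T -> U, set_fun A B g & {in A &, injective g}.
  by exists f => // x y /set_mem Ax /set_mem Ay; exact: finj.
exact: inj_card_le g.
Qed.

Lemma card_le_funP {T : Type} {U : pointedType} (A : set T) (B : set U) :
  A #<= B <-> exists2 f : T -> U, (forall x, A x -> B (f x)) &
    forall x y, A x -> A y -> f x = f y -> x = y.
Proof.
split=> [/pcard_leP /injfunPex[f fAB finj]|[f fAB finj]]; last exact: fun_card_le finj.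
by exists f => // x y Ax Ay; apply: finj; exact: mem_set.
Qed.

(** By [ex_card_min] the pair of [A] and [B] has a least member, which lies below the other. *)
Lemma card_le_or {T : pointedType} (A B : set T) : A #<= B \/ B #<= A.
Proof.
have [|D [->|->] minD] := @ex_card_min T [set A; B]; first by exists A; left.
- by left; apply: minD; right.
- by right; apply: minD; left.
Qed.

(** * Coding finite sequences over an infinite set by its elements *)

Definition seqs {T : eqType} (A : set T) : set (seq T) :=
  [set s | forall x, x \in s -> A x].

Lemma subset_seqs {T : eqType} (A B : set T) : A `<=` B -> seqs A `<=` seqs B.
Proof. by move=> AB s As x /As /AB. Qed.

Lemma card_le_seqs {T U : pointedType} (A : set T) (B : set U) :
  A #<= B -> seqs A #<= seqs B.
Proof.
move=> /card_le_funP[f fAB finj]; apply: (@fun_card_le _ _ _ _ (map f)).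
  by move=> s As _ /mapP[x xs ->]; apply: fAB; exact: As.
elim=> [|x s ih] [|y t] //= As At [fxy fst].
congr (_ :: _).
  by apply: finj => //; [apply: As|apply: At]; rewrite mem_head.
by apply: ih => // z zs; [apply: As|apply: At]; rewrite inE zs orbT.
Qed.

(* Elements of [A] are coded by singletons and those of [B] by constant pairs. *)
Lemma card_setU_le {T : pointedType} (A B : set T) :
  seqs A #<= A -> B #<= A -> A `|` B #<= A.
Proof.
move=> /card_le_funP[c cA cinj] /card_le_funP[k kBA kinj].
apply/card_le_funP.
have s1 x : A x -> seqs A [:: x] by move=> Ax y; rewrite inE => /eqP ->.
have s2 x : B x -> seqs A [:: k x; k x].
  by move=> /kBA Ax y; rewrite !inE orbb => /eqP ->.
exists (fun x => if pselect (A x) then c [:: x] else c [:: k x; k x]) => [x|x y].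
  by case: pselect => [Ax _|nAx [//|Bx]]; apply: cA; [exact: s1|exact: s2].
case: pselect => [Ax|nAx]; case: pselect => [Ay|nAy] Ux Uy.
- by move=> /(cinj _ _ (s1 _ Ax) (s1 _ Ay))[].
- by case: Uy => // By /(cinj _ _ (s1 _ Ax) (s2 _ By)).
- by case: Ux => // Bx /(cinj _ _ (s2 _ Bx) (s1 _ Ay)).
- case: Ux => // Bx; case: Uy => // By.
  by move=> /(cinj _ _ (s2 _ Bx) (s2 _ By))[] /kinj ->.
Qed.

(* Sequences over the union that are not over [A] are sent into [B], so the new
   map extends [c] and stays injective. *)
Lemma seqs_extend {T : pointedType} (A B : set T) (c : seq T -> T) :
    (forall s, seqs A s -> A (c s)) ->
    (forall s t, seqs A s -> seqs A t -> c s = c t -> s = t) ->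
    A `&` B = set0 -> A #= B ->
  exists c', [/\ (forall s, seqs (A `|` B) s -> (A `|` B) (c' s)),
    (forall s t, seqs (A `|` B) s -> seqs (A `|` B) t -> c' s = c' t -> s = t) &
    forall s, seqs A s -> c' s = c s].
Proof.
move=> cA cinj AB0; rewrite card_eq_le => /andP[AB BA].
have AA : seqs A #<= A by apply/card_le_funP; exists c.
(* The union is no larger than [A], so its sequences inject into those of [A], hence into [A] and
   then into [B]. *)
have /card_le_funP[h hB hinj] : seqs (A `|` B) #<= B.
  apply: card_le_trans _ (card_le_trans AA AB).
  by apply: card_le_seqs; exact: card_setU_le.
have nAB x : A x -> B x -> False by move=> Ax Bx; rewrite -[False]/(set0 x) -AB0.
exists (fun s => if pselect (seqs A s) then c s else h s); split=> [s|s t|s As].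
- by case: pselect => [As _|nAs Us]; [left; exact: cA|right; exact: hB].
- case: pselect => [As|nAs]; case: pselect => [At|nAt] Us Ut.
  + exact: cinj.
  + by move=> /= e; case: (nAB (c s)); [exact: cA|rewrite e; exact: hB].
  + by move=> /= e; case: (nAB (c t)); [exact: cA|rewrite -e; exact: hB].
  + exact: hinj.
- by case: pselect.
Qed.

Definition coding {T : eqType} (B : set T) (c : seq T -> T) : set (seq T * T) :=
  [set p | seqs B p.1 /\ p.2 = c p.1].

(* Injections are represented by their graphs, so that a chain has its union as
   an upper bound. *)
Definition codings {T : eqType} (A : set T) : set (set (seq T * T)) :=
  [set G | exists B c, [/\ B `<=` A, forall s, seqs B s -> B (c s),
     forall s t, seqs B s -> seqs B t -> c s = c t -> s = t & G = coding B c]].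

(** The finitely many entries of a sequence over the union of the domains lie in the domain of a
    single member of the chain, and that member decides the code. [F] is nonempty so that the empty
    sequence has a code. *)
Lemma codings_chain {T : pointedType} (A : set T) (F : set (set (seq T * T))) :
    F `<=` codings A -> F !=set0 -> total_on F subset ->
  codings A (\bigcup_(G in F) G).
Proof.
move=> Fcod [G0 FG0] Ftot.
pose U := \bigcup_(G in F) G.
(* [B] is the union of the domains, read off the graphs through one-letter sequences. *)
pose B := [set x | exists y, U ([:: x], y)].
have cover s : seqs B s -> exists2 D, exists c, F (coding D c) & seqs D s.
  elim: s => [|x s ih] Bxs.
    have [D [c [_ _ _ G0E]]] := Fcod _ FG0.
    by exists D => //; exists c; rewrite -G0E.
  have [|D [c Fc] Ds] := ih; first by move=> y ys; apply: Bxs; rewrite inE ys orbT.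
  have [y [G FG Gxy]] : B x by apply: Bxs; rewrite mem_head.
  have [E [e [_ _ _ GE]]] := Fcod _ FG; rewrite GE in FG Gxy.
  have [sub|sub] := Ftot _ _ Fc FG.
  - exists E; first by exists e.
    have [Es _] := sub (s, c s) (conj Ds erefl).
    move=> z; rewrite inE => /orP[/eqP->|/Es//].
    by case: Gxy => + _; apply; rewrite mem_head.
  - exists D; first by exists c.
    have [Dx _] := sub _ Gxy.
    by move=> z; rewrite inE => /orP[/eqP->|/Ds//]; apply: Dx; rewrite mem_head.
have functional D c s y : F (coding D c) -> seqs D s -> U (s, y) -> y = c s.
  move=> Fc Ds [G FG Gsy].
  have [E [e [_ _ _ GE]]] := Fcod _ FG; rewrite GE in FG Gsy.
  have [sub|sub] := Ftot _ _ Fc FG.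
  - by have [_ /= ->] := sub (s, c s) (conj Ds erefl); case: Gsy.
  - by have [] := sub _ Gsy.
have subB D c : F (coding D c) -> D `<=` B.
  move=> Fc x Dx; exists (c [:: x]), (coding D c) => //; split=> // y.
  by rewrite inE => /eqP ->.
pose u s := get [set y | U (s, y)].
have uE D c s : F (coding D c) -> seqs D s -> u s = c s.
  move=> Fc Ds; apply: functional (Ds) _ => //; apply: (@getPex _ (fun y => U (s, y))).
  by exists (c s), (coding D c).
exists B, u; split.
- move=> x [y [G FG Gxy]]; have [D [c [DA _ _ GE]]] := Fcod _ FG.
  by move: Gxy; rewrite GE => -[+ _] => /(_ x (mem_head _ _))/DA.
- move=> s /cover[D [c Fc] Ds]; rewrite (uE _ _ _ Fc Ds).
  (* [D] and [c] come only with their graph in [F]; the pair [E], [e] with the same graph carries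
     the properties of a coding. *)
  have [E [e [_ eE _ cE]]] := Fcod _ Fc.
  have : coding D c (s, c s) by [].
  by rewrite cE => -[/= Es ->]; apply: (subB E e); [rewrite -cE|exact: eE].
- move=> s t Bs Bt.
  (* Covering [s ++ t] yields one member that codes both [s] and [t], so its injectivity applies. *)
  have [|D [c Fc] Dst] := cover (s ++ t).
    by move=> x; rewrite mem_cat => /orP[/Bs|/Bt].
  have Ds : seqs D s by move=> x xs; apply: Dst; rewrite mem_cat xs.
  have Dt : seqs D t by move=> x xt; apply: Dst; rewrite mem_cat xt orbT.
  rewrite (uE _ _ _ Fc Ds) (uE _ _ _ Fc Dt).
  have [E [e [_ _ einj cE]]] := Fcod _ Fc.
  have : coding D c (s, c s) by [].
  have : coding D c (t, c t) by [].
  by rewrite cE => -[/= Et ->] [/= Es ->]; exact: einj.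
- apply/seteqP; split=> [[s y] [G FG Gsy]|[s y] [/= Bs ->]].
    have [D [c [_ _ _ GE]]] := Fcod _ FG; rewrite GE in FG Gsy.
    case: Gsy => /= Ds ->; split; first exact: subset_seqs (subB _ _ FG) _ Ds.
    by rewrite (uE _ _ _ FG Ds).
  have [D [c Fc] Ds] := cover _ Bs.
  by exists (coding D c) => //; split=> //=; exact: uE Fc Ds.
Qed.

(** A maximal coding lives on some [B] inside [A]. A copy of [B] in the rest of [A] would let
    [seqs_extend] enlarge it, so by comparability the rest injects into [B]; then so do [A] and
    [seqs A]. *)
Lemma card_seqs {T : pointedType} (A : set T) : infinite_set A -> seqs A #<= A.
Proof.
move=> /infiniteP natA.
have [G [GP Gmax]] : exists G, (G = set0 \/ codings A G) /\
    forall G', G `<` G' -> ~ (G' = set0 \/ codings A G').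
  apply: (@Zorn_bigcup _ (fun G => G = set0 \/ codings A G)) => F FP Ftot.
  have [[G1 [FG1 G1cod]]|nF] := pselect (exists G1, F G1 /\ codings A G1); last first.
    left; apply/seteqP; split=> // p [G FG Gp].
    have [G0|Gcod] := FP _ FG; first by rewrite -G0.
    by case: nF; exists G.
  right; have -> : \bigcup_(G in F) G = \bigcup_(G in F `&` codings A) G.
    apply/seteqP; split=> p [G FG Gp]; last by exists G => //; case: FG.
    have [G0|Gcod] := FP _ FG; first by rewrite G0 in Gp.
    by exists G.
  apply: codings_chain; first by move=> G [].
  - by exists G1.
  - by move=> G G' [FG _] [FG' _]; exact: Ftot.
(* Were the maximal graph empty, a coding over a countably infinite subset of [A] would properly
   extend it. *)
have [B [c [BA cB cinj GE]]] : codings A G.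
  case: GP => // G0.
  have /card_le_funP[f fA finj] := natA.
  pose B := range f.
  have BN : B #<= [set: nat] by exact: card_image_le.
  have NB : [set: nat] #<= B.
    by apply/card_le_funP; exists f => [x _|x y _ _]; [exists x|exact: finj].
  have : seqs B #<= B.
    apply: card_le_trans _ NB; apply: card_le_trans (card_le_seqs _ _ BN) _.
    exact: countableP.
  move=> /card_le_funP[c cB cinj].
  case: (Gmax (coding B c)); last by right; exists B, c; split=> // _ [n _ <-]; exact: fA.
  rewrite G0; split=> // /(_ ([::], c [::])); apply; split=> //.
have BB : seqs B #<= B by apply/card_le_funP; exists c.
suff AB : A #<= B.
  apply: card_le_trans _ (subset_card_le BA).
  exact: card_le_trans (card_le_seqs _ _ AB) BB.
have -> : A = B `|` (A `\` B) by rewrite setDUK.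
apply: card_setU_le => //.
have [//|] := card_le_or (A `\` B) B.
move=> /card_le_funP[j jAB jinj].
have jBA : j @` B `<=` A by move=> _ [x /jAB[] + _ <-].
have [||c' [c'B c'inj c'E]] := @seqs_extend T B (j @` B) c cB cinj.
- by apply/seteqP; split=> // x [Bx [y /jAB[_ +]]] => /[swap] ->.
- rewrite card_eq_sym; apply: inj_card_eq => x y /set_mem Bx /set_mem By.
  exact: jinj.
case: (Gmax (coding (B `|` j @` B) c')); last first.
  right; exists (B `|` j @` B), c'; split=> // x [/BA//|/jBA//].
rewrite GE; split=> [[s y] [/= Bs ->]|sub].
  split=> /=; last by rewrite c'E.
  by apply: subset_seqs Bs => x; left.
have Bc : B (c [::]) by exact: cB.
(* [c [::]] serves as a point of [B]; the one-letter sequence on its copy is coded by the new graph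
   but not by the old one. *)
have [] := sub ([:: j (c [::])], c' [:: j (c [::])]).
  by split=> // x; rewrite inE => /eqP ->; right; exists (c [::]).
by move=> /(_ _ (mem_head _ _)); case: (jAB _ Bc).
Qed.

(** * Non-dominating families and increasing open covers *)

Lemma escape_finite_max {T : pointedType} (H : set T) (f : T -> nat -> nat) :
    card_lt_d H ->
  exists g : nat -> nat, forall s, seqs H s -> forall k,
    exists2 n, (k <= n)%N & forall x, x \in s -> (f x n <= g n)%N.
Proof.
move=> [D [_ Dmin] [_ nDH]].
pose fmax s n := \max_(x <- s) f x n.
have fmaxP s n x : x \in s -> (f x n <= fmax s n)%N.
  by move=> xs; exact: (@leq_bigmax_seq _ s predT (fun y => f y n)).
have [/finite_seqP[s0 HE]|/card_seqs Hseq] := pselect (finite_set H).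
  (* A finite [H] has more finite sequences than elements; here the maximum over all of [H] serves
     at every [n]. *)
  exists (fmax s0) => s Hs k; exists k => // x /Hs; rewrite HE; exact: fmaxP.
(* If every [g] failed, each would be dominated by some [fmax s], and these maxima, no more numerous
   than [H], would form a dominating set. *)
apply: contrapT => ng; apply: nDH.
apply: card_le_trans Hseq; apply: card_le_trans (card_image_le fmax _).
apply: Dmin => g; apply: contrapT => ndom; apply: ng; exists g => s Hs k.
apply: contrapT => nn; apply: ndom; exists (fmax s); first by exists s.
exists k => // n /= kn; rewrite leqNgt; apply/negP => lt.
apply: nn; exists n => // x xs; exact: leq_trans (fmaxP _ _ _ xs) (ltnW lt).
Qed.

(* If no [G n0 m] contains [A], replacing [G n m] by [G n m `&` G n0 m] rules out
   the second alternative of the Hurewicz property. *)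
Lemma hurewicz_increasing {X : topologicalType} (A : set X)
    (G : nat -> nat -> set X) :
    hurewicz_subspace A -> (forall n m, open (G n m)) ->
    (forall n, {homo G n : m p / (m <= p)%N >-> m `<=` p}) ->
    (forall n x, A x -> exists m, G n m x) ->
  exists f : nat -> nat, forall x, A x -> \forall n \near \oo, G n (f n) x.
Proof.
move=> AH Gopen Gmono Gcov.
have [/choice[f fP]|/existsNP[n0 nA]] := pselect (forall n, exists m, A `<=` G n m).
  by exists f => x Ax; apply: nearW => n; exact: fP.
pose h n m : set (set_type A) := set_val @^-1` (G n m `&` G n0 m).
have hmono n m p : (m <= p)%N -> h n m `<=` h n p.
  by move=> mp x [? ?]; split; apply: Gmono mp _ _.
have [n|V VP alt] := AH (fun n => range (h n)).
  split=> [_ [m _ <-]|].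
    exists (G n m `&` G n0 m) => //; exact: openI.
  apply/seteqP; split=> // x _.
  have [[m Gm] [m0 Gm0]] := (Gcov n _ (set_valP x), Gcov n0 _ (set_valP x)).
  exists (h n (maxn m m0)); first by exists (maxn m m0).
  by split; [apply: Gmono Gm; exact: leq_maxl|apply: Gmono Gm0; exact: leq_maxr].
(* The finitely many members of [V n] are sets [h n m], which increase with [m], so one of them
   contains the union; the empty family takes index 0. *)
have /choice[f fP] : forall n, exists m, \bigcup_(B in V n) B `<=` h n m.
  move=> n; have [Vh Vfin] := VP n.
  have /finite_seqP[s sE] := Vfin.
  have : forall B, B \in s -> range (h n) B.
    by move=> B Bs; apply: Vh; rewrite sE.
  rewrite sE => {sE}; elim: s => [|B s ih] sh.
    by exists 0%N => x [].
  have [|m mP] := ih; first by move=> C Cs; apply: sh; rewrite inE Cs orbT.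
  have [p _ pE] := sh B (mem_head _ _).
  exists (maxn m p) => x [C /=]; rewrite inE => /orP[/eqP ->|Cs] Cx.
    by apply: hmono (leq_maxr m p) _ _; rewrite pE.
  by apply: hmono (leq_maxl m p) _ _; apply: mP; exists C.
exists f => x Ax; case: alt => [/(_ (SigSub (mem_set Ax)))|[n nX]].
  by apply: filterS => n /fP[].
case: nA; exists (f n) => y Ay.
have /fP[] // : (\bigcup_(B in V n) B) (SigSub (mem_set Ay)) by rewrite nX.
Qed.

(** * Stars and the final selection *)

Lemma near_seq {T : eqType} (s : seq T) (P : T -> nat -> Prop) :
  (forall x, x \in s -> \forall n \near \oo, P x n) ->
  \forall n \near \oo, forall x, x \in s -> P x n.
Proof.
elim: s => [|x s ih] sP; first exact: nearW.
have Ps : \forall n \near \oo, forall y, y \in s -> P y n.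
  by apply: ih => y ys; apply: sP; rewrite inE ys orbT.
apply: filterS2 (sP x (mem_head _ _)) Ps => n Px Psn y.
by rewrite inE => /orP[/eqP ->|/Psn].
Qed.

Lemma St_open {X : topologicalType} (A : set X) (U : set (set X)) :
  (forall B, U B -> open B) -> open (St A U).
Proof. by move=> Uopen; apply: bigcup_open => B [/Uopen]. Qed.

Lemma St_subset {X : Type} (A B : set X) (U : set (set X)) :
  A `<=` B -> St A U `<=` St B U.
Proof.
by move=> AB x [C [UC [y [/AB By Cy]]] Cx]; exists C => //; split=> //; exists y.
Qed.

Theorem theorem3p29 (X : topologicalType) (H : set (set X)) :
  strongly_star_lindelof X ->
  (forall A : set X, H A -> hurewicz_subspace A) ->
  card_lt_d H ->
  \bigcup_(A in H) A = [set: X] ->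
  strongly_star_scheepers X.
Proof.
move=> XL Hhur Hd Hcov U Ucov.
have /choice[A AP] : forall n, exists A, countable A /\ St A (U n) = [set: X].
  by move=> n; have [A] := XL _ (Ucov n); exists A.
have /countable_injP[e einj] : countable (\bigcup_n A n).
  by apply: bigcup_countable => // n _; case: (AP n).
(* One numbering [e] of all the [A n] serves every cover; its injectivity leaves at most [m.+1]
   points in [K m]. *)
pose K m := [set x | (\bigcup_n A n) x /\ (e x <= m)%N].
have Kfin m : finite_set (K m).
  apply/finite_set_leP; exists m.+1; apply: (@fun_card_le _ _ _ _ e) => [x []//|].
  by move=> x y [Ax _] [Ay _]; apply: einj; exact: mem_set.
pose G n m := St (K m) (U n).
have Gmono n : {homo G n : m p / (m <= p)%N >-> m `<=` p}.
  by move=> m p mp; apply: St_subset => x [Ax xm]; split=> //; exact: leq_trans mp.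
have Gopen n m : open (G n m) by apply: St_open; case: (Ucov n).
have Gcov n x : exists m, G n m x.
  have [_ /seteqP[_ /(_ x)]] := AP n; case=> // B [UB [y [Ay By]]] Bx.
  by exists (e y), B => //; split=> //; exists y; split=> //; split=> //; exists n.
have /choice[f fP] : forall B : set X, exists f : nat -> nat,
    H B -> forall x, B x -> \forall n \near \oo, G n (f n) x.
  move=> B; have [HB|nHB] := pselect (H B); last by exists (fun=> 0%N).
  have [//|f fP] := hurewicz_increasing B G (Hhur _ HB) Gopen Gmono.
  by exists f.
have [g gP] := escape_finite_max H f Hd.
have /choice[b bP] : forall x, exists B, H B /\ B x.
  move=> x; have [B HB Bx] : (\bigcup_(B in H) B) x by rewrite Hcov.
  by exists B.
have omega F : finite_set F -> exists n, F `<=` G n (g n).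
  move=> /finite_seqP[s ->].
  (* From [k] on, every [x] in [s] lies in the star of index [f (b x) n]; at some such [n] the value
     [g n] is at least all these indices. *)
  have [|k _ kP] := near_seq s (fun x n => G n (f (b x) n) x).
    by move=> x _; have [Hb bx] := bP x; exact: fP.
  have [|n kn nP] := gP (map b s) _ k.
    by move=> _ /mapP[x _ ->]; case: (bP x).
  exists n => x xs; apply: Gmono (kP n kn x xs); apply: nP; exact: map_f.
exists (fun n => K (g n)) => //; split; first split.
- by move=> _ [n _ <-]; exact: Gopen.
(* That the stars cover [X] is the case of singletons. *)
- apply/seteqP; split=> // x _; have [n nP] := omega _ (finite_set1 x).
  by exists (G n (g n)); [exists n|exact: nP].
- by move=> F /omega[n nP]; exists (G n (g n)) => //; exists n.
Qed.
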